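(* If the permutation class $\mathcal{C}$ lies in the grid class of a matching, i.e. $\mathcal{C}\subseteq\operatorname{Grid}(M)$ for some matrix $M$ with entries in $\{0,1,-1\}$ such that $G(M)$ is a matching, then there is a polynomial $p(n)$ such that $|\mathcal{C}_n|=p(n)$ for all sufficiently large $n$.
   Context: Write $[n]=\{1,\dots,n\}$ and let $S_n$ be the set of permutations of $[n]$. A permutation $\pi\in S_n$ contains $\sigma\in S_k$ (written $\sigma\le\pi$) if $\pi$ has a subsequence of length $k$ in the same relative order as $\sigma$. A permutation class is a set $\mathcal{C}$ of permutations such that $\pi\in\mathcal{C}$ and $\sigma\le\pi$ imply $\sigma\in\mathcal{C}$. We write $\mathcal{C}_n=\mathcal{C}\cap S_n$. For $\pi\in S_n$ and $A,B\subseteq[n]$, $\pi(A\times B)$ denotes the subsequence of $\pi$ consisting of the entries $\pi(i)$ with $i\in A$ and $\pi(i)\in B$. Empty and one-term sequences count as both increasing and decreasing. A $t\times u$ matrix $M$ means a matrix with entries in $\{0,1,-1\}$ having $t$ columns and $u$ rows, where $M_{k,\ell}$ is the entry in the $k$th column from the left and the $\ell$th row from the bottom. An $M$-gridding of $\pi\in S_n$ is a pair of integer sequences $1=c_1\le c_2\le\cdots\le c_{t+1}=n+1$ and $1=r_1\le r_2\le\cdots\le r_{u+1}=n+1$ such that for all $k\in[t]$, $\ell\in[u]$, the subsequence $\pi([c_k,c_{k+1})\times[r_\ell,r_{\ell+1}))$ is increasing if $M_{k,\ell}=1$, decreasing if $M_{k,\ell}=-1$, and empty if $M_{k,\ell}=0$.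 (Here $[a,b)=\{a,a+1,\dots,b-1\}$.) The grid class $\operatorname{Grid}(M)$ is the set of all permutations that possess an $M$-gridding. For a $t\times u$ matrix $M$, $G(M)$ is the bipartite graph with vertices $x_1,\dots,x_t,y_1,\dots,y_u$ and edges $x_ky_\ell$ precisely when $M_{k,\ell}\ne 0$. A matching is a graph in which no two distinct edges share a vertex (every vertex has degree at most $1$). *)

(* Defs.v *)
From mathcomp Require Import all_boot all_order all_fingroup all_algebra.

Set Implicit Arguments.
Unset Strict Implicit.
Unset Printing Implicit Defensive.

(* Positions and values are 0-based: a permutation of [n] is an element of
   'S_n, i.e. it acts on 'I_n = {0, ..., n-1}.  A set of permutations is given
   by its layers, so C n is the set C_n of its elements of length n. *)
Definition perm_set := forall n : nat, {set 'S_n}.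

Definition contains (k n : nat) (sigma : 'S_k) (pi : 'S_n) : Prop :=
  exists f : 'I_k -> 'I_n,
    (forall i j : 'I_k, i < j -> f i < f j) /\
    (forall i j : 'I_k, (sigma i < sigma j) = (pi (f i) < pi (f j))).

Definition is_perm_class (C : perm_set) : Prop :=
  forall (k n : nat) (sigma : 'S_k) (pi : 'S_n),
    pi \in C n -> contains sigma pi -> sigma \in C k.

(* pi(A x B); enum lists the positions in increasing order. *)
Definition subword (n : nat) (pi : 'S_n) (A B : {set 'I_n}) : seq nat :=
  [seq (pi i : nat) | i <- enum A & pi i \in B].

Definition ivl (n a b : nat) : {set 'I_n} := [set i : 'I_n | a <= i < b].

Definition sign_entries (t u : nat) (M : 'M[int]_(t, u)) : Prop :=
  forall k l, [\/ M k l = 0%R, M k l = 1%R | M k l = (-1)%R].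

Definition fits_entry (x : int) (s : seq nat) : Prop :=
  [/\ x = 1%R -> sorted ltn s,
      x = (-1)%R -> sorted gtn s
    & x = 0%R -> s = [::]].

(* In contrast with the usual matrix convention, M k l is the entry in the
   k-th column from the left and the l-th row from the bottom, so that
   'M_(t, u) is the type of matrices with t columns and u rows.
   Because of 0-based indexing, the sequences c and r run from 0 to n
   instead of from 1 to n + 1. *)
Definition is_gridding (t u : nat) (M : 'M[int]_(t, u)) (n : nat) (pi : 'S_n)
    (c : t.+1.-tuple nat) (r : u.+1.-tuple nat) : Prop :=
  [/\ [/\ tnth c ord0 = 0, sorted leq c & tnth c ord_max = n],
      [/\ tnth r ord0 = 0, sorted leq r & tnth r ord_max = n]
    & forall (k : 'I_t) (l : 'I_u),
        fits_entry (M k l)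
          (subword pi (ivl n (nth 0 c k) (nth 0 c k.+1))
                      (ivl n (nth 0 r l) (nth 0 r l.+1)))].

Definition in_grid (t u : nat) (M : 'M[int]_(t, u)) (n : nat) (pi : 'S_n)
    : Prop :=
  exists (c : t.+1.-tuple nat) (r : u.+1.-tuple nat), is_gridding M pi c r.

(* The graph G(M): inl k is the vertex x_k and inr l is the vertex y_l. *)
Definition cell_graph (t u : nat) (M : 'M[int]_(t, u))
    : rel ('I_t + 'I_u)%type :=
  fun x y => match x, y with
             | inl k, inr l | inr l, inl k => M k l != 0%R
             | _, _ => false
             end.

Definition is_matching (T : finType) (e : rel T) : Prop :=
  forall x : T, #|[set y | e x y]| <= 1.

(* Main.v *)
Require Import Defs.
From mathcomp Require Import all_boot all_order all_fingroup all_algebra.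
From mathcomp Require Import zify ring.
From Stdlib Require Import Classical.

(** When G(M) is a matching, every column of M has at most one nonzero cell and
    that cell is alone in its row.  So a gridded permutation is determined by
    the vector a of its t column widths: two entries lying in different
    columns compare as the rows of their cells do, and two entries in the same
    column compare according to the sign of its cell (gridding_encodes).
    Counting C_n thus amounts to counting vectors of sum n, except that one
    permutation may have several griddings, hence several vectors.

    To repair this, keep for each permutation only its canonical vector, the
    one whose word (the weakly increasing word that lists the column of each
    position) is lexicographically least.  The key point is that the set S of
    canonical vectors of members of C is downward closed in every coordinate
    that is already large.  Suppose that a has entry a_i > t.  If a + e_i
    encodes a member of C, so does a, by deleting an entry.  If a is not
    canonical, let b be a vector for the same permutation with a smaller word.
    Column i of a has more than t positions, so two consecutive ones, x and
    x + 1, lie in the same column j of b.  Doubling the entry at x turns a into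
    a + e_i and b into b + e_j; these still encode a common permutation, since
    the order of the two copies is that of the entries at x and x + 1 in both
    encodings, and the word of b + e_j is still the smaller one.  So a + e_i
    is not canonical either (dup_same_order, canonical_tame).

    It remains to count the vectors of sum n in a set S with this closure
    property (ev_poly_count), by induction on t.  The slices of S at first
    coordinate c have the same property and decrease once c is large.  A
    decreasing sequence of such sets is eventually constant (tame_stable, a
    form of Dickson's lemma), so for large n the count is the sum of finitely
    many shifted eventually polynomial functions and of a partial sum of
    another one. *)

Set Implicit Arguments.
Unset Strict Implicit.
Unset Printing Implicit Defensive.

Import GRing.Theory Num.Theory.

(** * Eventually polynomial functions *)

Definition ev_poly (f : nat -> nat) : Prop :=
  exists p : {poly rat}, exists N : nat, forall n : nat, N <= n ->
    ((f n)%:R = p.[n%:R])%R.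

Lemma ev_poly_ext N f g :
  (forall n, N <= n -> f n = g n) -> ev_poly f -> ev_poly g.
Proof.
move=> fg [p [N' fp]]; exists p, (maxn N N') => n.
by rewrite geq_max => /andP[leNn leN'n]; rewrite -fg // fp.
Qed.

Lemma ev_poly0 : ev_poly (fun=> 0).
Proof. by exists 0%R, 0 => n _; rewrite horner0. Qed.

Lemma ev_polyD f g : ev_poly f -> ev_poly g -> ev_poly (fun n => f n + g n).
Proof.
move=> [p [N fp]] [q [N' gq]]; exists (p + q)%R, (maxn N N') => n.
by rewrite geq_max => /andP[leNn leN'n]; rewrite hornerD natrD fp // gq.
Qed.

Lemma ev_poly_sum m (F : nat -> nat -> nat) :
  (forall c, ev_poly (F c)) -> ev_poly (fun n => \sum_(c < m) F c n).
Proof.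
move=> evF; elim: m => [|m IHm].
  by apply: (@ev_poly_ext 0 (fun=> 0)) ev_poly0 => n _; rewrite big_ord0.
apply: (@ev_poly_ext 0 (fun n => \sum_(c < m) F c n + F m n)).
  by move=> n _; rewrite big_ord_recr.
exact: ev_polyD.
Qed.

Lemma ev_poly_shift c f : ev_poly f -> ev_poly (fun n => f (n - c)).
Proof.
move=> [p [N fp]]; exists (p \Po ('X - c%:R%:P))%R, (N + c) => n leNn.
rewrite fp; last by lia.
by rewrite horner_comp !hornerE natrB //; lia.
Qed.

(** In the basis of falling factorials B_k = X (X - 1) ... (X - k + 1), the
    difference operator acts like a derivative: it maps B_(k+1) to (k+1) B_k.
    Rather than expanding p in this basis, the induction treats a product
    r * B_k: dividing r by X - k leaves a constant multiple of B_k and a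
    quotient times B_(k+1), where the quotient has smaller degree than r. *)
Lemma poly_antidiff (p : {poly rat}) :
  exists q : {poly rat}, forall x : rat, (q.[x + 1] - q.[x] = p.[x])%R.
Proof.
pose B k : {poly rat} := (\prod_(i < k) ('X - i%:R%:P))%R.
have B_S k : B k.+1 = (B k * ('X - k%:R%:P))%R by rewrite /B big_ord_recr.
have B_shift k (x : rat) : ((B k.+1).[x + 1] = (x + 1) * (B k).[x])%R.
  elim: k => [|k IHk]; first by rewrite B_S /B big_ord0 !hornerE /=; ring.
  by rewrite B_S hornerM IHk (B_S k) hornerM !hornerXsubC -natr1; ring.
have diffB k (x : rat) :
    ((B k.+1).[x + 1] - (B k.+1).[x] = k.+1%:R * (B k).[x])%R.
  by rewrite B_shift B_S hornerM hornerXsubC -natr1; ring.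
suff main d : forall (r : {poly rat}) k, size r <= d ->
    exists q : {poly rat},
      forall x : rat, (q.[x + 1] - q.[x] = (r * B k).[x])%R.
  have [q qP] := main (size p) p 0 (leqnn _).
  by exists q => x; rewrite qP /B big_ord0 mulr1.
elim: d => [|d IHd] r k.
  rewrite leqn0 size_poly_eq0 => /eqP->.
  by exists 0%R => x; rewrite mul0r !horner0 subrr.
move=> size_r.
have /factor_theorem[s rs] : root (r - (r.[k%:R])%:P)%R (k%:R : rat).
  by rewrite /root !hornerE subrr.
have [q qP] : exists q : {poly rat},
    forall x : rat, (q.[x + 1] - q.[x] = (s * B k.+1).[x])%R.
  apply: IHd; have [->|s_neq0] := eqVneq s 0%R; first by rewrite size_poly0.
  have : size (s * ('X - k%:R%:P))%R <= d.+1.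
    rewrite -rs (leq_trans (size_polyD _ _)) // geq_max size_r size_polyN.
    by rewrite (leq_trans (size_polyC_leq1 _)).
  by rewrite size_Mmonic ?monicXsubC // size_XsubC addn2.
exists (q + (r.[k%:R] / k.+1%:R) *: B k.+1)%R => x.
rewrite -[in RHS](subrK (r.[k%:R])%:P%R r) rs.
set c := (r.[k%:R])%R; rewrite !hornerD !hornerZ opprD addrACA qP -mulrBr diffB.
have k1_neq0 : (k.+1%:R != 0 :> rat)%R by rewrite pnatr_eq0.
have -> : (c / k.+1%:R * (k.+1%:R * (B k).[x]) = c * (B k).[x])%R.
  by rewrite mulrA mulfVK.
rewrite B_S mulrDl hornerD !hornerM hornerC /=; ring.
Qed.

Lemma ev_poly_psum f : ev_poly f -> ev_poly (fun n => \sum_(k < n) f k).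
Proof.
move=> [p [N fp]]; have [q qP] := poly_antidiff p.
pose c := ((\sum_(k < N) f k)%:R - q.[N%:R])%R.
exists (q + c%:P)%R, N => n leNn; rewrite -(subnK leNn).
elim: (n - N) => [|d IHd]; first by rewrite add0n hornerD hornerC addrC subrK.
rewrite addSn big_ord_recr natrD IHd !hornerD !hornerC /= fp ?leq_addl //.
by rewrite -qP -natr1; ring.
Qed.

(** * Counting vectors in a set closed downwards in its large coordinates *)

(** Listing the vectors by their first coordinate gives the recursion along
    which they are counted. *)
Fixpoint comps (t n : nat) : seq (seq nat) :=
  if t is t'.+1 then [seq c :: a | c <- iota 0 n.+1, a <- comps t' (n - c)]
  else if n == 0 then [:: [::]] else [::].

Lemma compsS t n :
  comps t.+1 n = [seq c :: a | c <- iota 0 n.+1, a <- comps t (n - c)].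
Proof. by []. Qed.

Lemma mem_comps t n a : (a \in comps t n) = (size a == t) && (sumn a == n).
Proof.
elim: t n a => [|t IHt] n a; first by case: n a => [|n] [|c a].
rewrite compsS; apply/allpairsPdep/idP => [[c [b []]]|].
  rewrite mem_iota IHt => /andP[_ led] /andP[sz /eqP sm] -> /=.
  by rewrite eqSS sz; apply/eqP; lia.
case: a => // c a; rewrite [size _]/= [sumn _]/= eqSS => /andP[sz /eqP sm].
exists c, a; split=> //.
  by rewrite mem_iota; lia.
by rewrite IHt sz; apply/eqP; lia.
Qed.

Lemma comps_uniq t n : uniq (comps t n).
Proof.
elim: t n => [|t IHt] n; first by case: n.
rewrite compsS; apply: allpairs_uniq_dep; first exact: iota_uniq.
  by move=> c _; apply: IHt.
by move=> [c a] [d b] _ _ /= [-> ->].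
Qed.

(** Down-sets of N^t are tame for K = 0; for larger K, membership is arbitrary
    among the coordinates below K. *)
Definition tame (K t : nat) (S : pred (seq nat)) : Prop :=
  forall a i, size a = t -> i < t -> K <= nth 0 a i -> S (incr_nth a i) -> S a.

Lemma tame_slice K t S c : tame K t.+1 S -> tame K t (fun a => S (c :: a)).
Proof.
move=> tameS a i sz_a ltit leKai.
by apply: (tameS (c :: a) i.+1) => //=; rewrite sz_a.
Qed.

Lemma tame_slice_anti K t S c a :
  tame K t.+1 S -> K <= c -> size a = t -> S (c.+1 :: a) -> S (c :: a).
Proof.
by move=> tameS leKc sz_a; apply: (tameS (c :: a) 0) => //=; rewrite sz_a.
Qed.

(** The descending chain condition for tame sets.  In dimension t + 1, slice
    the sets at a value d of the first coordinate.  The slices decrease both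
    in the index c and in d, for d >= K, so the diagonal c = d is a decreasing
    chain of tame sets of dimension t.  Once it is constant, from D on, every
    slice with c, d >= D is squeezed between two diagonal ones.  The finitely
    many values d < D are treated one by one by induction. *)
Lemma tame_stable K t (S : nat -> pred (seq nat)) :
    (forall c, tame K t (S c)) ->
    (forall c a, size a = t -> S c.+1 a -> S c a) ->
  exists d, forall c a, d <= c -> size a = t -> S c a = S d a.
Proof.
elim: t S => [|t IHt] S tameS antiS.
  have [[d S0d]|S0] := classic (exists d, ~~ S d [::]); last first.
    exists 0 => c a _ /size0nil->.
    have S1 d : S d [::] by apply/negPn/negP=> Sd; case: S0; exists d.
    by rewrite !S1.
  exists d => c a led /size0nil->; rewrite (negPf S0d); apply: negbTE.
  elim: c led => [|c IHc]; first by rewrite leqn0 => /eqP<-.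
  by rewrite leq_eqVlt => /predU1P[<-//|/IHc]; apply/contra/antiS.
have anti c c' a : c <= c' -> size a = t.+1 -> S c' a -> S c a.
  move=> lecc' sz_a; elim: c' lecc' => [|c' IHc'].
    by rewrite leqn0 => /eqP->.
  by rewrite leq_eqVlt => /predU1P[->//|/IHc'] SS /antiS-/(_ sz_a)/SS.
have anti_row c d d' a :
    K <= d -> d <= d' -> size a = t -> S c (d' :: a) -> S c (d :: a).
  move=> leKd ledd' sz_a; elim: d' ledd' => [|d' IHd'].
    by rewrite leqn0 => /eqP->.
  rewrite leq_eqVlt => /predU1P[->//|led] Sd'; apply: IHd' => //.
  by apply: (tame_slice_anti (tameS c)) Sd' => //; exact: leq_trans leKd led.
have [d0 d0P] : exists d0, forall c a, d0 <= c -> size a = t ->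
    S (c + K) ((c + K) :: a) = S (d0 + K) ((d0 + K) :: a).
  apply: (IHt (fun c a => S (c + K) ((c + K) :: a))) => [c|c a sz_a Sc].
    exact: tame_slice.
  apply: (anti _ (c.+1 + K)); rewrite ?leq_add2r //= ?sz_a //.
  by apply: anti_row Sc => //; rewrite ?leq_add2r ?leq_addl.
(* From here on the diagonal is constant, and slices decrease in d as well. *)
pose D := d0 + K.
have D_P c d a : D <= c -> D <= d -> size a = t -> S c (d :: a) = S D (D :: a).
  move=> leDc leDd sz_a; pose e := maxn c d.
  have TeD : S e (e :: a) = S D (D :: a).
    have leDe : D <= e by rewrite leq_max leDc.
    have := d0P (e - K) a; rewrite subnK; last by lia.
    by apply=> //; lia.
  apply/idP/idP => [Sc|]; last rewrite -TeD => Se.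
    by apply: (anti _ c); rewrite //= ?sz_a //; apply: anti_row Sc;
      rewrite // leq_addl.
  apply: (anti_row _ _ e); rewrite ?leq_maxr ?(leq_trans _ leDd) ?leq_addl //.
  by apply: (anti _ e); rewrite //= ?sz_a ?leq_maxl.
have [E E_P] : exists E, forall d c a, d < D -> E <= c -> size a = t ->
    S c (d :: a) = S E (d :: a).
  elim: (D) => [|D' [E E_P]]; first by exists 0.
  have [c|c a sz_a|E' E'_P] := IHt (fun c a => S c (D' :: a)).
  - exact: tame_slice.
  - by apply: antiS; rewrite /= sz_a.
  exists (maxn E E') => d c a; rewrite ltnS leq_eqVlt geq_max.
  move=> /predU1P[->|ltd] /andP[leE leE'] sz_a.
    by rewrite E'_P // [RHS]E'_P ?leq_maxr.
  by rewrite E_P // [RHS]E_P ?leq_maxl.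
exists (maxn D E) => c [|d a] //; rewrite geq_max => /andP[leD leE] [sz_a].
have [ltdD|leDd] := ltnP d D.
  by rewrite E_P // [RHS]E_P ?leq_maxr.
by rewrite D_P // [RHS]D_P ?leq_maxl.
Qed.

Lemma count_comps_cons t (S : pred (seq nat)) n :
  count S (comps t.+1 n) =
    \sum_(c < n.+1) count (fun a => S ((c : nat) :: a)) (comps t (n - c)).
Proof.
rewrite compsS count_flatten -map_comp sumnE big_map.
rewrite -[iota 0 n.+1]/(index_iota 0 n.+1).
by rewrite big_mkord; apply: eq_bigr => c _ /=; rewrite count_map.
Qed.

(** The slices at first coordinate c >= D all agree with the one at D, so their
    contributions add up to a partial sum of its counting function. *)
Lemma ev_poly_count K t (S : pred (seq nat)) :
  tame K t S -> ev_poly (fun n => count S (comps t n)).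
Proof.
elim: t S => [|t IHt] S tameS.
  by exists 0%R, 1 => -[|n] // _; rewrite horner0.
have [d dP] : exists d, forall c a, d <= c -> size a = t ->
    S ((c + K) :: a) = S ((d + K) :: a).
  apply: (@tame_stable K t (fun c a => S ((c + K) :: a))) => [c|c a sz_a].
    exact: tame_slice.
  by apply: (tame_slice_anti tameS); rewrite ?leq_addl.
pose D := d + K; pose slice c a := S (c :: a).
have stable c a : D <= c -> size a = t -> slice c a = slice D a.
  move=> leDc sz_a; rewrite /slice -(dP (c - K)) ?subnK //; lia.
pose f c n := count (slice c) (comps t n).
have ev_f c : ev_poly (f c) by apply/IHt/tame_slice.
apply: (@ev_poly_ext D
  (fun n => \sum_(c < D) f c (n - c) + \sum_(k < n.+1 - D) f D k)); last first.
  apply: ev_polyD.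
    apply: (@ev_poly_sum D (fun c n => f c (n - c))) => c.
    exact: ev_poly_shift.
  have := ev_poly_shift D (ev_poly_psum (ev_f D)) => -[p [N pP]].
  exists (p \Po ('X + 1%:P))%R, N => n leNn.
  by rewrite pP ?leqW // horner_comp !hornerE natr1.
move=> n leDn; rewrite count_comps_cons.
rewrite -[RHS](big_mkord xpredT (fun c => count (slice c) (comps t (n - c)))).
rewrite [RHS](big_cat_nat (n := D)) /= ?leqW //; congr (_ + _).
  by rewrite big_mkord.
rewrite -(big_mkord xpredT (f D)) big_nat_rev.
rewrite -[X in _ = \sum_(X <= _ < _) _]add0n big_addn.
apply: eq_big_nat => k /andP[_ ltk]; rewrite add0n.
have -> : n.+1 - D - k.+1 = n - (k + D) by lia.
apply: eq_in_count => a; rewrite mem_comps => /andP[/eqP sz_a _].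
by rewrite stable ?leq_addl.
Qed.

(** * Vectors as weakly increasing words *)

(** The index of the block that contains position x, when consecutive blocks
    have the sizes listed in a. *)
Fixpoint cell (a : seq nat) (x : nat) : nat :=
  if a is c :: a' then if x < c then 0 else (cell a' (x - c)).+1 else 0.

Lemma cell_mono a : {homo cell a : x y / x <= y}.
Proof.
elim: a => //= c a IHa x y lexy; case: (ltnP y c) => [ltyc|leyc].
  by rewrite (leq_ltn_trans lexy ltyc).
by case: ltnP => // lecx; rewrite ltnS; apply: IHa; lia.
Qed.

Lemma cell_lt a x : x < sumn a -> cell a x < size a.
Proof.
elim: a x => //= c a IHa x ltx; case: (ltnP x c) => // lecx.
by rewrite ltnS; apply: IHa; lia.
Qed.

Lemma cell_eq a x i : i < size a ->
  (cell a x == i) = (sumn (take i a) <= x < sumn (take i.+1 a)).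
Proof.
elim: a x i => // c a IHa x [|i] /=.
  by case: (ltnP x c); rewrite take0 /=; lia.
rewrite ltnS => /IHa-/(_ (x - c)) IH; case: (ltnP x c) => [ltxc|lecx].
  by apply/esym/negbTE; lia.
by rewrite eqSS IH /=; lia.
Qed.

Lemma cell_inj a b : size a = size b -> sumn a = sumn b ->
  (forall x, x < sumn a -> cell a x = cell b x) -> a = b.
Proof.
elim: a b => [|c a IHa] [|d b] //= [sz] sm eq_cell.
have eq_cd : c = d.
  apply/eqP; rewrite eqn_leq; apply/andP; split; rewrite leqNgt; apply/negP.
    by move=> lt; have := eq_cell d; rewrite ltnn lt; lia.
  by move=> lt; have := eq_cell c; rewrite ltnn lt; lia.
rewrite eq_cd in sm eq_cell *; congr (_ :: _); apply: IHa => //; first by lia.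
move=> x ltx; have /eq_cell : x + d < d + sumn a by lia.
by rewrite !ltnNge leq_addl /= addnK => -[].
Qed.

Lemma sumn_incr_nth_lt a i : i < size a -> sumn (incr_nth a i) = (sumn a).+1.
Proof.
by elim: a i => [//|c a IHa] [|i] //=; rewrite ltnS => /IHa->; rewrite addnS.
Qed.

Lemma size_incr_nth_lt a i : i < size a -> size (incr_nth a i) = size a.
Proof. by move=> lti; rewrite size_incr_nth lti. Qed.

(** Enlarging the block of x by one doubles the letter at position x; unbump x
    identifies the two copies, x and x + 1. *)
Lemma cell_incr a x y :
  x < sumn a -> cell (incr_nth a (cell a x)) y = cell a (unbump x y).
Proof.
elim: a x y => // c a IHa x y /= ltx; rewrite /unbump.
case: (ltnP x c) => [ltxc|lecx] /=.
  case: (ltnP x y) => [ltxy|leyx] /=; last by rewrite subn0 !ifT //; lia.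
  rewrite subn1 ltnS; case: (leqP y c) => [leyc|ltcy].
    by rewrite ifT //; lia.
  by rewrite ifF; [congr (cell _ _).+1|apply/negbTE]; lia.
case: (ltnP y c) => [ltyc|leyc]; first by rewrite ifT //; lia.
rewrite ifF; last by apply/negbTE; lia.
rewrite IHa; last by lia.
by rewrite /unbump; congr (cell _ _).+1; lia.
Qed.

Lemma unbumpK x y : unbump x (bump x.+1 y) = y.
Proof. by rewrite /unbump /bump; lia. Qed.

(** Without a plateau, f would increase by at least one at each of the m steps
    from p to p + m and reach the value m. *)
Lemma mono_plateau (f : nat -> nat) m p :
    {homo f : x y / x <= y} -> f (p + m) < m ->
  exists2 k, k < m & f (p + k) = f (p + k).+1.
Proof.
move=> f_mono ltf; have [/existsP[k /eqP fk]|] :=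
  boolP [exists k : 'I_m, f (p + k) == f (p + k).+1]; first by exists k.
rewrite negb_exists => /forallP f_strict.
suff: forall k, k <= m -> k <= f (p + k) by move/(_ m (leqnn m)); lia.
elim=> // k IHk ltkm; rewrite addnS.
have := f_mono _ _ (leqnSn (p + k)); have /= := f_strict (Ordinal ltkm).
by have := IHk (ltnW ltkm); lia.
Qed.

Lemma minimal_mem (T : eqType) (r : rel T) (s : seq T) (x : T) :
    irreflexive r -> transitive r -> x \in s ->
  exists2 y, y \in s & forall z, z \in s -> ~~ r z y.
Proof.
move=> irr tr; elim: s x => // x0 s IHs x _.
case: s IHs => [|x1 s] IHs.
  by exists x0; rewrite ?mem_head // => z; rewrite inE => /eqP->; rewrite irr.
have [y ys minx] := IHs x1 (mem_head _ _).
have [rxy|nrxy] := boolP (r x0 y).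
  exists x0; rewrite ?mem_head // => z; rewrite inE => /predU1P[->|/minx].
    by rewrite irr.
  by apply: contra => /tr/(_ rxy).
exists y; first by rewrite inE ys orbT.
by move=> z; rewrite inE => /predU1P[->|/minx].
Qed.

(** Words rather than vectors are compared because doubling the letters at one
    common position preserves the first difference between two words. *)
Definition lexlt (n : nat) (b a : seq nat) : bool :=
  [exists d : 'I_n, (cell b d < cell a d) &&
     [forall y : 'I_n, (y < d) ==> (cell b y == cell a y)]].

Lemma lexltP n b a :
  reflect (exists d, [/\ d < n, cell b d < cell a d
                       & forall y, y < d -> cell b y = cell a y])
          (lexlt n b a).
Proof.
apply: (iffP existsP) => [[d /andP[ltd /forallP eqd]]|[d [ltdn ltd eqd]]].
  exists d; split=> // y ltyd; apply/eqP.
  exact: (implyP (eqd (Ordinal (ltn_trans ltyd (ltn_ord d))))).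
exists (Ordinal ltdn); rewrite ltd; apply/forallP => y; apply/implyP => ltyd.
by rewrite eqd.
Qed.

Lemma lexlt_irr n : irreflexive (lexlt n).
Proof. by move=> a; apply/lexltP => -[d []]; rewrite ltnn. Qed.

Lemma lexlt_trans n : transitive (lexlt n).
Proof.
move=> b a c /lexltP[d [ltdn ltd eqd]] /lexltP[d' [ltd'n ltd' eqd']].
apply/lexltP; have [lt|lt|eq_dd'] := ltngtP d d'.
- by exists d; rewrite -eqd'//; split=> // y lty; rewrite eqd // eqd'//; lia.
- by exists d'; rewrite eqd //; split=> // y lty; rewrite eqd ?eqd'//; lia.
exists d; split=> //; first by rewrite (ltn_trans ltd) // eq_dd'.
by move=> y lty; rewrite eqd ?eqd' -?eq_dd'.
Qed.

Lemma lexlt_total n a b : size a = size b -> sumn a = n -> sumn b = n ->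
  a != b -> lexlt n a b || lexlt n b a.
Proof.
move=> sz sma smb; apply: contraNT; rewrite negb_or => /andP[nab nba].
apply/eqP/cell_inj; rewrite ?sma ?smb // => x.
elim/ltn_ind: x => x IHx ltxn; apply/eqP; rewrite eqn_leq.
apply/andP; split; rewrite leqNgt.
  apply: contra nba => lt; apply/lexltP; exists x; split=> // y lty.
  by rewrite IHx // (ltn_trans lty).
apply: contra nab => lt; apply/lexltP; exists x; split=> // y lty.
by rewrite IHx // (ltn_trans lty).
Qed.

(** * Permutations encoded by a vector *)

(** The comparison rule g between blocks is arbitrary: g i j decides whether an
    entry in block i is below a later entry in block j, the case i = j
    included. *)
Section Encoding.

Variable g : rel nat.

Definition same_order (n : nat) (a b : seq nat) : bool :=
  [forall x : 'I_n, forall y : 'I_n, (x < y) ==>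
     (g (cell a x) (cell a y) == g (cell b x) (cell b y))].

Lemma same_orderP n a b :
  reflect (forall x y, x < y < n ->
             g (cell a x) (cell a y) = g (cell b x) (cell b y))
          (same_order n a b).
Proof.
apply: (iffP forallP) => [gab x y /andP[ltxy ltyn]|gab x].
  have ltxn := ltn_trans ltxy ltyn.
  apply/eqP; have /forallP/(_ (Ordinal ltyn)) := gab (Ordinal ltxn).
  by rewrite /= ltxy.
by apply/forallP => y; apply/implyP => ltxy; rewrite gab // ltxy ltn_ord.
Qed.

Definition encodes (n : nat) (a : seq nat) (pi : 'S_n) : bool :=
  [forall x : 'I_n, forall y : 'I_n, (x < y) ==>
     ((pi x < pi y) == g (cell a x) (cell a y))].

Lemma encodesP n a (pi : 'S_n) :
  reflect (forall x y : 'I_n, x < y ->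
             (pi x < pi y) = g (cell a x) (cell a y))
          (encodes a pi).
Proof.
apply: (iffP forallP) => [enc x y ltxy|enc x].
  exact: eqP (implyP (forallP (enc x) y) ltxy).
by apply/forallP => y; apply/implyP => ltxy; rewrite enc.
Qed.

(** The heart of the argument: a smaller vector b that encodes the same
    permutation as a survives the growth of a large block of a, because one
    can double an entry x for which the positions x and x + 1 share a block in
    a and in b.  Comparing the two copies of x then amounts, in both
    encodings, to comparing x and x + 1. *)
Lemma dup_same_order n t a b i :
    size a = t -> sumn a = n -> size b = t -> sumn b = n ->
    same_order n a b -> lexlt n b a -> i < t -> t < nth 0 a i ->
  exists b', [/\ size b' = t, sumn b' = n.+1,
                 same_order n.+1 (incr_nth a i) b'
               & lexlt n.+1 b' (incr_nth a i)].
Proof.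
move=> sza sma szb smb /same_orderP gab /lexltP[d [ltdn ltd eqd]] ltit ltai.
pose p := sumn (take i a).
have takeS : sumn (take i.+1 a) = p + nth 0 a i.
  by rewrite (take_nth 0) ?sza // sumn_rcons.
have le_n : p + nth 0 a i <= n.
  by rewrite -takeS -sma -{2}(cat_take_drop i.+1 a) sumn_cat leq_addr.
have cell_a k : k <= t -> cell a (p + k) = i.
  by move=> lekt; apply/eqP; rewrite cell_eq ?sza // takeS; lia.
have [k ltkt plateau] : exists2 k, k < t & cell b (p + k) = cell b (p + k).+1.
  by apply: mono_plateau; [exact: cell_mono | rewrite -szb cell_lt //; lia].
set x := p + k in plateau.
have ltxn : x.+1 < n by rewrite /x; lia.
have ax : cell a x = i by apply: cell_a; apply: ltnW.
have ax1 : cell a x.+1 = i by rewrite /x -addnS cell_a.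
have cell_a' y : cell (incr_nth a i) y = cell a (unbump x y).
  by rewrite -ax cell_incr // sma ltnW.
have cell_b' y : cell (incr_nth b (cell b x)) y = cell b (unbump x y).
  by rewrite cell_incr // smb ltnW.
have ltbx : cell b x < size b by rewrite cell_lt // smb ltnW.
exists (incr_nth b (cell b x)); split.
- by rewrite size_incr_nth_lt.
- by rewrite sumn_incr_nth_lt ?smb.
- apply/same_orderP => y z /andP[ltyz ltzn]; rewrite !cell_a' !cell_b'.
  have [lt|ge] := ltnP (unbump x y) (unbump x z).
    by apply: gab; rewrite lt /unbump; lia.
  have -> : unbump x y = x by move: ge; rewrite /unbump; lia.
  have -> : unbump x z = x by move: ge; rewrite /unbump; lia.
  (* Here y and z are the two copies of x. *)
  have := gab x x.+1; rewrite -plateau ax ax1; apply; lia.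
apply/lexltP; exists (bump x.+1 d); split.
- by rewrite /bump; lia.
- by rewrite cell_a' cell_b' unbumpK.
move=> y lty; rewrite cell_a' cell_b' eqd //.
by move: lty; rewrite /unbump /bump; lia.
Qed.

End Encoding.

Lemma card_ord_lt n m : m <= n -> #|[set z : 'I_n | z < m]| = m.
Proof.
move=> lemn; rewrite -sum1dep_card -(big_ord_widen n (fun=> 1)) //.
by rewrite sum1_card card_ord.
Qed.

(** A permutation is recovered from its order relation because the value at x
    is the number of values below it. *)
Lemma perm_order_inj n (s1 s2 : 'S_n) :
  (forall x y : 'I_n, x < y -> (s1 x < s1 y) = (s2 x < s2 y)) -> s1 = s2.
Proof.
move=> s12; have s12' x y : (s1 x < s1 y) = (s2 x < s2 y).
  have [/s12//|ltyx|/val_inj->] := ltngtP x y; last by rewrite !ltnn.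
  have neq (s : 'S_n) : (s x < s y) = ~~ (s y < s x).
    rewrite -leqNgt [RHS]leq_eqVlt orb_idl // => /eqP/val_inj/perm_inj eq_xy.
    by rewrite eq_xy ltnn in ltyx.
  by rewrite neq s12 // -neq.
have rank (s : 'S_n) x : s x = #|[set y | s y < s x]| :> nat.
  rewrite -[LHS](@card_ord_lt n) 1?ltnW //.
  rewrite -(card_preimset [set z : 'I_n | z < s x] (@perm_inj _ s)).
  by apply: eq_card => y; rewrite !inE.
apply/permP => x; apply: val_inj; rewrite /= rank [RHS]rank.
by apply: eq_card => y; rewrite !inE.
Qed.

Lemma standardization n (h : 'I_n -> nat) : injective h ->
  exists s : 'S_n, forall x y : 'I_n, (s x < s y) = (h x < h y).
Proof.
move=> h_inj; pose below x := [set y | h y < h x].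
have below_lt x : #|below x| < n.
  rewrite -[n in _ < n]card_ord -cardsT; apply: proper_card.
  by apply/properP; split; [exact: subsetT | exists x; rewrite ?inE ?ltnn].
pose r x := Ordinal (below_lt x).
have r_mono x y : h x < h y -> r x < r y.
  move=> ltxy; apply/proper_card/properP; split.
    by apply/subsetP => z; rewrite !inE => /ltn_trans->.
  by exists x; rewrite !inE ?ltnn.
have rE x y : (r x < r y) = (h x < h y).
  apply/idP/idP => [|/r_mono//]; apply: contraLR; rewrite -!leqNgt leq_eqVlt.
  by case/predU1P => [/h_inj->//|/r_mono/ltnW].
have r_inj : injective r.
  move=> x y eqr; apply: h_inj; apply/eqP; rewrite eqn_leq.
  by apply/andP; split; rewrite leqNgt -rE eqr ltnn.
by exists (perm r_inj) => x y; rewrite !permE.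
Qed.

(** * Counting a class through canonical vectors *)

Section ClassCount.

Variables (g : rel nat) (C : perm_set) (t : nat).
Hypothesis hC : is_perm_class C.

Definition encodes_some (n : nat) (a : seq nat) : bool :=
  [exists pi in C n, encodes g a pi].

Lemma encodes_some_decr n a i : sumn a = n -> i < size a -> 0 < nth 0 a i ->
  encodes_some n.+1 (incr_nth a i) -> encodes_some n a.
Proof.
move=> sma ltia ai_gt0 /exists_inP[pi piC /encodesP enc].
pose x := sumn (take i a).
have takeS : sumn (take i.+1 a) = x + nth 0 a i.
  by rewrite (take_nth 0) // sumn_rcons.
have ax : cell a x = i by apply/eqP; rewrite cell_eq // takeS; lia.
have ltxn : x < n.
  rewrite -sma -(cat_take_drop i.+1 a) sumn_cat takeS; lia.
(* Block i of the larger vector contains x and x + 1; the pattern omits the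
   entry at x + 1. *)
pose f : 'I_n -> 'I_n.+1 := lift (Ordinal (ltxn : x.+1 < n.+1)).
have f_mono (y z : 'I_n) : y < z -> f y < f z by rewrite /= /bump; lia.
have [s sP] : exists s : 'S_n, forall y z : 'I_n,
    (s y < s z) = (pi (f y) < pi (f z)).
  by apply: standardization => y z /val_inj/perm_inj/lift_inj.
apply/exists_inP; exists s; first by apply: (hC piC); exists f.
apply/encodesP => y z ltyz; rewrite sP enc ?f_mono // -ax.
by rewrite !cell_incr ?sma // /f /= !unbumpK.
Qed.

Definition canonical (n : nat) (a : seq nat) : bool :=
  encodes_some n a &&
  ~~ has (fun b => same_order g n a b && lexlt n b a) (comps t n).

(** The threshold t + 1 leaves more than t positions in block i, enough for two
    consecutive ones to share one of the t blocks of another vector. *)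
Lemma canonical_tame : tame t.+1 t (fun a => canonical (sumn a) a).
Proof.
move=> a i sza ltit ltai; have ltia : i < size a by rewrite sza.
rewrite /canonical sumn_incr_nth_lt // => /andP[enc' minim].
rewrite (encodes_some_decr _ _ _ enc') ?(leq_ltn_trans _ ltai) //=.
apply: contra minim => /hasP[b].
rewrite mem_comps => /andP[/eqP szb /eqP smb] /andP[same ltba].
have [b' [szb' smb' same' ltb']] :=
  dup_same_order sza erefl szb smb same ltba ltit ltai.
by apply/hasP; exists b'; rewrite ?same' // mem_comps szb' smb' !eqxx.
Qed.

Lemma encodes_same_order n a b (pi : 'S_n) :
  encodes g a pi -> encodes g b pi = same_order g n a b.
Proof.
move=> /encodesP enc_a; apply/encodesP/same_orderP => [enc_b x y|gab x y ltxy].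
  case/andP=> ltxy ltyn; have ltxn := ltn_trans ltxy ltyn.
  by rewrite -(enc_a (Ordinal ltxn) (Ordinal ltyn)) // enc_b.
by rewrite enc_a // gab // ltxy ltn_ord.
Qed.

Lemma encodes_inj n a (s1 s2 : 'S_n) :
  encodes g a s1 -> encodes g a s2 -> s1 = s2.
Proof.
move=> /encodesP enc1 /encodesP enc2; apply: perm_order_inj => x y ltxy.
by rewrite enc1 // enc2.
Qed.

Lemma canonical_unique n a b (pi : 'S_n) :
    a \in comps t n -> b \in comps t n -> canonical n a -> canonical n b ->
  encodes g a pi -> encodes g b pi -> a = b.
Proof.
move=> at_ bt /andP[_ mina] /andP[_ minb] enc_a enc_b.
apply/eqP/contraT => neq_ab.
have := at_; have := bt; rewrite !mem_comps.
case/andP=> /eqP szb /eqP smb /andP[/eqP sza /eqP sma].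
have /orP[lt|lt] := lexlt_total (etrans sza (esym szb)) sma smb neq_ab.
  case/hasP: minb; exists a; rewrite // lt -(encodes_same_order _ enc_b).
  by rewrite enc_a.
case/hasP: mina; exists b; rewrite // lt -(encodes_same_order _ enc_a).
by rewrite enc_b.
Qed.

(** Double counting of the pairs of a permutation in C_n and a canonical vector
    that encodes it: each side is paired exactly once. *)
Lemma card_class_canonical n :
    (forall pi, pi \in C n -> exists2 a, a \in comps t n & encodes g a pi) ->
  #|C n| = count (canonical n) (comps t n).
Proof.
move=> has_code; rewrite -size_filter; set A := [seq _ <- _ | _].
have A_uniq : uniq A by rewrite filter_uniq // comps_uniq.
have memA a : (a \in A) = canonical n a && (a \in comps t n).
  by rewrite mem_filter.
have count_code pi : pi \in C n -> \sum_(a <- A | encodes g a pi) 1 = 1.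
  move=> piC; have [a0 a0t enc0] := has_code pi piC.
  have : a0 \in [seq a <- comps t n | encodes g a pi].
    by rewrite mem_filter enc0.
  case/(minimal_mem (@lexlt_irr n) (@lexlt_trans n)) => a.
  rewrite mem_filter => /andP[enc_a a_t] min_a.
  have aA : a \in A.
    rewrite memA a_t andbT; apply/andP; split.
      by apply/exists_inP; exists pi.
    apply/hasPn => b bt; rewrite -(encodes_same_order _ enc_a).
    apply/negP => /andP[enc_b]; apply/negP/min_a.
    by rewrite mem_filter enc_b.
  rewrite (big_rem a) //= enc_a big_seq_cond big1 ?addn0 // => b.
  rewrite mem_rem_uniq // inE => /andP[/andP[/negP neq bA] enc_b]; case: neq.
  move: aA bA; rewrite !memA => /andP[can_a _] /andP[can_b bt].
  by apply/eqP; apply: (@canonical_unique n b a pi).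
have count_perm a : a \in A -> \sum_(pi in C n | encodes g a pi) 1 = 1.
  rewrite memA => /andP[/andP[/exists_inP[pi piC enc] _] _].
  rewrite (big_pred1 pi) // => s; apply/andP/eqP => [[_ enc_s]|->//].
  exact: encodes_inj enc_s enc.
rewrite -sum1_card (eq_bigr _ (fun pi piC => esym (count_code pi piC))).
rewrite (exchange_big_dep xpredT) //= big_seq.
rewrite (eq_bigr (fun=> 1)) => [|a aA]; last by rewrite count_perm.
by rewrite -big_seq sum1_size.
Qed.

Theorem encoded_class_ev_poly :
    (forall n pi, pi \in C n -> exists2 a, a \in comps t n & encodes g a pi) ->
  ev_poly (fun n => #|C n|).
Proof.
move=> has_code; apply: (@ev_poly_ext 0 _ _ _ (ev_poly_count canonical_tame)).
move=> n _; rewrite card_class_canonical; last exact: has_code.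
by apply: eq_in_count => a; rewrite mem_comps => /andP[_ /eqP->].
Qed.

End ClassCount.

(** * Griddings by a matching *)

Definition gaps (m : nat) (c : seq nat) : seq nat :=
  mkseq (fun k => nth 0 c k.+1 - nth 0 c k) m.

Section Gaps.

Variables (m n : nat) (c : m.+1.-tuple nat).
Hypotheses (c0 : tnth c ord0 = 0) (c_sorted : sorted leq c)
           (cm : tnth c ord_max = n).

Lemma nth_cuts_mono i j : i <= j -> j <= m -> nth 0 c i <= nth 0 c j.
Proof.
move=> leij lejm; apply: (sorted_leq_nth leq_trans leqnn) => //.
  by rewrite inE size_tuple ltnS (leq_trans leij).
by rewrite inE size_tuple ltnS.
Qed.

Lemma sumn_take_gaps k : k <= m -> sumn (take k (gaps m c)) = nth 0 c k.
Proof.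
elim: k => [|k IHk] ltkm.
  by rewrite take0 -[RHS](tnth_nth 0 c ord0) c0.
rewrite (take_nth 0) ?size_mkseq // sumn_rcons IHk ?(ltnW ltkm) // nth_mkseq //.
by rewrite subnKC // nth_cuts_mono.
Qed.

Lemma gaps_comps : gaps m c \in comps m n.
Proof.
have sz : size (gaps m c) = m by rewrite size_mkseq.
rewrite mem_comps sz eqxx -[gaps m c]take_size sz sumn_take_gaps //.
by apply/eqP; rewrite -cm (tnth_nth 0).
Qed.

Lemma cell_gaps x : x < n ->
  exists2 k : 'I_m, cell (gaps m c) x = k & nth 0 c k <= x < nth 0 c k.+1.
Proof.
have := gaps_comps; rewrite mem_comps => /andP[/eqP sz /eqP sm] ltxn.
have ltm : cell (gaps m c) x < m.
  by have := @cell_lt (gaps m c) x; rewrite sm sz; apply.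
exists (Ordinal ltm) => //=.
by rewrite -(sumn_take_gaps (ltnW ltm)) -(sumn_take_gaps ltm) -cell_eq ?sz.
Qed.

End Gaps.

(** The entries of a cell are listed from left to right, so sortedness of the
    subword compares any two of them. *)
Lemma subword_sorted (n : nat) (pi : 'S_n) (A B : {set 'I_n}) (r : rel nat)
    (x y : 'I_n) :
    transitive r -> sorted r (subword pi A B) -> x < y ->
    x \in A -> y \in A -> pi x \in B -> pi y \in B ->
  r (pi x) (pi y).
Proof.
move=> r_tr; rewrite /subword sorted_map; set s := [seq i <- _ | _] => s_r ltxy.
have s_lt : sorted (relpre val ltn) s.
  rewrite -sorted_map; apply: (subseq_sorted ltn_trans _ (iota_ltn_sorted 0 n)).
  rewrite -val_enum_ord; apply/map_subseq/(subseq_trans (filter_subseq _ _)).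
  by rewrite {1}/enum_mem -enumT filter_subseq.
move=> xA yA pxB pyB.
have xs : x \in s by rewrite mem_filter pxB mem_enum.
have ys : y \in s by rewrite mem_filter pyB mem_enum.
have r_pi_tr : transitive (relpre (fun i => pi i : nat) r).
  by move=> ? ? ?; apply: r_tr.
have lt_tr : transitive (relpre (val : 'I_n -> nat) ltn).
  by move=> ? ? ?; apply: ltn_trans.
apply: (sorted_ltn_index r_pi_tr s_r) => //.
rewrite ltnNge leq_eqVlt; apply/negP => /predU1P[eq_ix|lt_ix].
  by move: ltxy; rewrite -(nth_index x xs) -eq_ix nth_index // ltnn.
have /= := sorted_ltn_index lt_tr s_lt _ _ ys xs lt_ix; lia.
Qed.

Section Matching.

Variables (t u : nat) (M : 'M[int]_(t, u)).
Hypotheses (hM : sign_entries M) (hmatch : is_matching (cell_graph M)).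

Lemma matching_row k l l' : M k l != 0%R -> M k l' != 0%R -> l = l'.
Proof.
move=> nz nz'; have /card_le1_eqP le1 := hmatch (inl k).
by have := le1 (inr l) (inr l'); rewrite !inE => /(_ nz nz')[].
Qed.

Lemma matching_col k k' l : M k l != 0%R -> M k' l != 0%R -> k = k'.
Proof.
move=> nz nz'; have /card_le1_eqP le1 := hmatch (inr l).
by have := le1 (inl k) (inl k'); rewrite !inE => /(_ nz nz')[].
Qed.

(** The comparison rule of M: entries in different columns compare as the rows
    of their cells, and entries in the same column by the sign of its cell. *)
Definition column_order : rel nat := fun i j =>
  [exists k : 'I_t, exists k' : 'I_t, exists l, exists l',
    [&& k == i :> nat, k' == j :> nat, M k l != 0%R, M k' l' != 0%R
      & if k == k' then M k l == 1%R else l < l']].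

Lemma column_orderE k k' l l' : M k l != 0%R -> M k' l' != 0%R ->
  column_order k k' = if k == k' then M k l == 1%R else l < l'.
Proof.
move=> nz nz'; apply/existsP/idP.
  case=> k1 /existsP[k2 /existsP[l1 /existsP[l2]]].
  case/and5P => /eqP/val_inj-> /eqP/val_inj-> nz1 nz2.
  by rewrite (matching_row nz1 nz) (matching_row nz2 nz').
move=> ord; exists k; apply/existsP; exists k'; apply/existsP; exists l.
by apply/existsP; exists l'; rewrite !eqxx nz nz' ord.
Qed.

Lemma gridding_encodes n (pi : 'S_n) c r : is_gridding M pi c r ->
  encodes column_order (gaps t c) pi.
Proof.
case=> -[c0 c_sorted ct] [r0 r_sorted ru] fits; apply/encodesP => x y ltxy.
have [k -> kx] := cell_gaps c0 c_sorted ct (ltn_ord x).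
have [k' -> ky] := cell_gaps c0 c_sorted ct (ltn_ord y).
have [l _ lx] := cell_gaps r0 r_sorted ru (ltn_ord (pi x)).
have [l' _ ly] := cell_gaps r0 r_sorted ru (ltn_ord (pi y)).
have nonzero (z : 'I_n) (j : 'I_t) (i : 'I_u) :
    nth 0 c j <= z < nth 0 c j.+1 -> nth 0 r i <= pi z < nth 0 r i.+1 ->
  M j i != 0%R.
  move=> jz iz; apply/eqP => Mji0; have [_ _ /(_ Mji0) empty] := fits j i.
  have : (pi z : nat) \in ([::] : seq nat).
    rewrite -empty; apply/mapP; exists z => //.
    by rewrite mem_filter mem_enum !inE iz jz.
  by [].
have nzx := nonzero _ _ _ kx lx; have nzy := nonzero _ _ _ ky ly.
rewrite (column_orderE nzx nzy); case: eqP => [eq_kk'|neq_kk'].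
  rewrite -eq_kk' in ky nzy; rewrite -(matching_row nzx nzy) in ly.
  have [inc dec _] := fits k l.
  have [M0|M1|MN1] := hM k l; first by rewrite M0 eqxx in nzx.
    rewrite M1 eqxx; apply: (subword_sorted ltn_trans (inc M1)) => //;
      by rewrite inE.
  rewrite MN1; apply/negbTE; rewrite -leqNgt ltnW //.
  apply: (subword_sorted (r := gtn) _ (dec MN1)); rewrite ?inE //.
  by move=> p q s /= lt1 lt2; apply: ltn_trans lt2 lt1.
have [lt|gt|/val_inj eq_ll'] := ltngtP l l'.
- have := nth_cuts_mono r_sorted lt (ltnW (ltn_ord l')); lia.
- have := nth_cuts_mono r_sorted gt (ltnW (ltn_ord l)); lia.
by case: neq_kk'; apply: (matching_col nzx); rewrite eq_ll'.
Qed.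

End Matching.

Theorem theorem2p9 (C : perm_set) (hC : is_perm_class C)
    (t u : nat) (M : 'M[int]_(t, u)) (hM : sign_entries M)
    (hmatch : is_matching (cell_graph M))
    (hgrid : forall (n : nat) (pi : 'S_n), pi \in C n -> in_grid M pi) :
  exists p : {poly rat}, exists N : nat, forall n : nat, N <= n ->
    (#|C n|%:R = p.[n%:R])%R.
Proof.
apply: (encoded_class_ev_poly (g := column_order M) (t := t) hC) => n pi.
case/hgrid => c [r grid]; exists (gaps t c); last exact: gridding_encodes grid.
by case: grid => -[c0 c_sorted ct] _ _; apply: gaps_comps.
Qed.
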